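(* Let $s\geq 1$ be an integer and let $L$ be the subdivision of the $1$-simplex by $s$ interior vertices (a path with $s+1$ edges). Then for every $n\geq 0$ the generalized Tchebyshev polynomial of the second kind $U^{L,2}_n(x)$ has $n$ distinct real roots in the open interval $(-1,1)$.
   Context: Simplicial complexes are finite abstract simplicial complexes, containing the empty face. The link of a face $\sigma$ of $K$ is $\mathrm{link}_K(\sigma)=\{\tau\in K: \sigma\cap\tau=\emptyset,\ \sigma\cup\tau\in K\}$. $f_i(K)$ is the number of $i$-dimensional faces of $K$. The $F$-polynomial of $K$ is $F(K,x)=\sum_{j=0}^{\dim K+1} f_{j-1}(K)\left(\frac{x-1}{2}\right)^j$. Here $\partial(L)$ consists of the empty face and the two endpoints of the path $L$; $V(\partial(L))$ is the set of the two endpoints. A simplicial complex $K'$ is a generalized Tchebyshev triangulation of $K$ induced by $L$ if there is an ordered list $\sigma_1,\ldots,\sigma_m$ of the edges of $K$, listing each exactly once, bijections $\phi_{\sigma_i}:V(\partial(L))\to\sigma_i$, and simplicial complexes $K_0=K,K_1,\ldots,K_m=K'$ such that for each $i\geq 1$ the complex $K_i$ is obtained from $K_{i-1}$ as follows: take an isomorphic copy $L_i$ of $L$ in which each boundary vertex $w\in V(\partial(L))$ is identified with $\phi_{\sigma_i}(w)$ and the interior vertices are new vertices, and replace the family of faces $\{\sigma_i\cup\tau:\tau\in\mathrm{link}_{K_{i-1}}(\sigma_i)\}$ by the family $\{\sigma'\cup\tau:\sigma'\in L_i,\ \tau\in\mathrm{link}_{K_{i-1}}(\sigma_i)\}$.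 There is a unique linear map $U^{L,2}:\mathbb{R}[x]\to\mathbb{R}[x]$ satisfying $U^{L,2}(1)=0$ and such that for every simplicial complex $K$ and every generalized Tchebyshev triangulation $K'$ of $K$ induced by $L$, $$U^{L,2}(F(K,x))=\sum_{\sigma\in K,\ |\sigma|=1}F(\mathrm{link}_{K'}(\sigma),x)$$ (sum over the original vertices of $K$). One defines $U^{L,2}_n(x)=\tfrac12\,U^{L,2}(x^{n+1})$. *)

(* Defs.v *)
From HB Require Import structures.
From mathcomp Require Import all_boot all_order all_algebra.
From mathcomp Require Import finmap reals.

Set Implicit Arguments.
Unset Strict Implicit.
Unset Printing Implicit Defensive.

Import Order.TTheory GRing.Theory Num.Theory.

Local Open Scope fset_scope.
Local Open Scope ring_scope.

(** A finite abstract simplicial complex is represented by its set of faces;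
    the vertices are the [v] such that [[fset v]] is a face, so [V] itself may
    be infinite and provide fresh vertices. *)

Definition simplicial_complex (V : choiceType) (K : {fset {fset V}}) : Prop :=
  fset0 \in K /\
  (forall sigma tau : {fset V},
     sigma \in K -> tau `<=` sigma -> tau \in K).

Definition link (V : choiceType) (K : {fset {fset V}}) (sigma : {fset V}) :
    {fset {fset V}} :=
  [fset tau in K | (sigma `&` tau == fset0) && (sigma `|` tau \in K)].

(** Faces are indexed by cardinality: [nb_faces K j] is $f_{j-1}(K)$ and
    [max_card K] is $\dim K + 1$. *)

Definition nb_faces (V : choiceType) (K : {fset {fset V}}) (j : nat) : nat :=
  #|` [fset tau in K | #|` tau| == j] |.

Definition max_card (V : choiceType) (K : {fset {fset V}}) : nat :=
  (\max_(tau <- K) #|` tau|)%N.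

Definition Fpoly (R : realType) (V : choiceType) (K : {fset {fset V}}) :
    {poly R} :=
  \sum_(0 <= j < (max_card K).+1)
    (nb_faces K j)%:R *: (2^-1 *: ('X - 1)) ^+ j.

Definition edges (V : choiceType) (K : {fset {fset V}}) : {fset {fset V}} :=
  [fset tau in K | #|` tau| == 2%N].

(** The path with [s] interior vertices has vertices 0, 1, ..., s+1 and
    endpoints 0 and s+1. *)

Definition path_vertices (s : nat) : {fset nat} :=
  [fset i | i in iota 0 s.+2].

Definition path_endpoints (s : nat) : {fset nat} := [fset 0%N; s.+1].

Definition path_complex (s : nat) : {fset {fset nat}} :=
  fset0 |` ([fset [fset i] | i in iota 0 s.+2]
            `|` [fset [fset i; i.+1] | i in iota 0 s.+1]).

(** [g] maps the path onto its copy $L_i$: restricted to the endpoints it is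
    the bijection $\phi_{\sigma}$ onto [sigma], and it sends the interior
    vertices to distinct vertices which are not in [K]. *)

Definition path_copy (V : choiceType) (s : nat) (K : {fset {fset V}})
    (sigma : {fset V}) (g : nat -> V) : Prop :=
  [/\ {in path_vertices s &, injective g},
      g @` path_endpoints s = sigma &
      {in path_vertices s `\` path_endpoints s,
         forall i, [fset g i] \notin K}].

Definition subdivide (V : choiceType) (s : nat) (K : {fset {fset V}})
    (sigma : {fset V}) (g : nat -> V) : {fset {fset V}} :=
  (K `\` [fset sigma `|` tau | tau in link K sigma])
  `|` [fset (g @` rho) `|` tau | rho : {fset nat} in path_complex s,
                                tau : {fset V} in link K sigma].

Fixpoint tchebyshev_chain (V : choiceType) (s : nat) (K : {fset {fset V}})
    (es : seq {fset V}) (K' : {fset {fset V}}) : Prop :=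
  match es with
  | [::] => K' = K
  | sigma :: es' =>
      exists (g : nat -> V) (K1 : {fset {fset V}}),
        [/\ path_copy s K sigma g, K1 = subdivide s K sigma g,
            simplicial_complex K1 & tchebyshev_chain s K1 es' K']
  end.

Definition tchebyshev_triangulation (V : choiceType) (s : nat)
    (K K' : {fset {fset V}}) : Prop :=
  exists es : seq {fset V},
    [/\ uniq es, es =i edges K & tchebyshev_chain s K es K'].

(** The characteristic property of the linear map $U^{L,2}$. *)

Definition is_tchebyshev_U (R : realType) (s : nat)
    (U : {poly R} -> {poly R}) : Prop :=
  U 1 = 0 /\
  (forall (V : choiceType) (K K' : {fset {fset V}}),
     simplicial_complex K -> tchebyshev_triangulation s K K' ->
     U (Fpoly R K) =
       \sum_(sigma <- K | #|` sigma| == 1%N) Fpoly R (link K' sigma)).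

Definition tchebyshev_U_poly (R : realType) (U : {poly R} -> {poly R})
    (n : nat) : {poly R} :=
  2^-1 *: U 'X^(n.+1).

(* Main.v *)
Require Import Defs.
From mathcomp Require Import all_boot all_order all_algebra.
From mathcomp Require Import finmap reals.
From mathcomp Require Import trigo.
From mathcomp Require Import ring zify.

(** Write [h] for the polynomial [(X - 1) / 2], so that the F-polynomial of a
    complex is the sum of [h ^+ #|tau|] over its faces.  The proof finds [U]
    explicitly and then recognizes a rescaled Chebyshev polynomial.

    Identification of [U].  Subdividing an edge replaces each face containing
    it by faces that contain an inner face of the path: [s] inner vertices,
    [s - 1] edges between inner vertices, and two edges with one old endpoint.
    Give a face with [m] new and [j] old vertices the weight [h ^+ m * q j].
    The total weight of the complex survives the subdivision of an edge between
    old vertices as soon as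
      [q (j + 2) = 2 h q (j + 1) + (s h + (s - 1) h ^+ 2) q j].
    With [q 0 = 0] and [q 1 = 1], the total weight of [K] is the sum of
    [q #|tau|] over its faces.  At the end of the process all the edges of [K]
    are gone, no face has two old vertices, and the total weight is the sum of
    the F-polynomials of the links of the old vertices ([sum_vertex_links]).
    Every complex with vertices in [nat] has a triangulation, because fresh
    vertices are available; the full simplices then force [U (h ^+ k) = q k]
    ([tchebyshev_U_half_shift]), by induction on [k].

    Recurrence.  As the powers of [h] span all polynomials, the recurrence for
    [q] becomes one for [U ('X ^+ k)]: writing [P n] for the polynomial of the
    second kind, [P 0 = 1], [P 1 = 2 X] and
      [P (n + 2) = 2 X P (n + 1) - D P n],  with [D = s - (s - 1) X ^+ 2].

    Roots.  If [x = r cos theta] with [r ^+ 2 = D x], the recurrence is that of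
    the Chebyshev polynomials up to powers of [r], whence
      [P n x * sin theta = r ^+ n * sin ((n + 1) theta)].
    Such an [r] exists for each [theta], and depends only on [c = cos theta];
    the map from [c] to [r c] is injective and sends the open interval (-1, 1)
    into itself.  The angles [k pi / (n + 1)] with [1 <= k <= n] therefore give
    [n] distinct roots in (-1, 1), and there is no other root because the
    degree of [P n] is at most [n]. *)

Set Implicit Arguments.
Unset Strict Implicit.
Unset Printing Implicit Defensive.

Import Order.TTheory GRing.Theory Num.Theory.

Local Open Scope fset_scope.
Local Open Scope ring_scope.

(** * Links and faces of the path *)

Lemma mem_link (V : choiceType) (K : {fset {fset V}}) (sigma tau : {fset V}) :
  (tau \in link K sigma) =
    [&& tau \in K, [disjoint sigma & tau]%fset & sigma `|` tau \in K].
Proof. by rewrite !inE. Qed.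

Lemma path_complexP (s : nat) (rho : {fset nat}) :
  reflect [\/ rho = fset0, exists2 i, (i <= s.+1)%N & rho = [fset i]
            | exists2 i, (i <= s)%N & rho = [fset i; i.+1]]
    (rho \in path_complex s).
Proof.
rewrite !inE; apply: (iffP or3P) => -[].
- by move=> /eqP ->; constructor 1.
- move=> /imfsetP[i]; rewrite -[_ \in _]/(i \in iota 0 s.+2) mem_iota => /= hi ->.
  by constructor 2; exists i.
- move=> /imfsetP[i]; rewrite -[_ \in _]/(i \in iota 0 s.+1) mem_iota => /= hi ->.
  by constructor 3; exists i.
- by move=> ->; constructor 1.
- move=> [i hi ->]; constructor 2; apply/imfsetP; exists i => //.
  by rewrite -[_ \in _]/(i \in iota 0 s.+2) mem_iota.
- move=> [i hi ->]; constructor 3; apply/imfsetP; exists i => //.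
  by rewrite -[_ \in _]/(i \in iota 0 s.+1) mem_iota.
Qed.

Lemma mem_path_vertices (s i : nat) :
  (i \in path_vertices s) = (i <= s.+1)%N.
Proof. by rewrite in_fset mem_iota add0n. Qed.

Lemma path_complex_sub (s : nat) (rho : {fset nat}) :
  rho \in path_complex s -> rho `<=` path_vertices s.
Proof.
move=> /path_complexP[->|[i hi ->]|[i hi ->]]; first exact: fsub0set.
  by rewrite fsub1set mem_path_vertices.
by rewrite fsubUset !fsub1set !mem_path_vertices; lia.
Qed.

Lemma path_complex_simplicial (s : nat) :
  simplicial_complex (path_complex s).
Proof.
split=> [|rho rho' hrho hsub]; first by apply/path_complexP; constructor 1.
have h1 i : (i <= s.+1)%N -> [fset i] \in path_complex s.
  by move=> hi; apply/path_complexP; constructor 2; exists i.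
have h0 : fset0 \in path_complex s by apply/path_complexP; constructor 1.
move/path_complexP: hrho hsub => [->|[i hi ->]|[i hi ->]].
- by rewrite fsubset0 => /eqP ->.
- by rewrite fsubset1 => /orP[] /eqP -> //; apply: h1.
- move=> hsub.
  case hi0 : (i \in rho'); case hi1 : (i.+1 \in rho').
  + suff -> : rho' = [fset i; i.+1] by apply/path_complexP; constructor 3; exists i.
    by apply/eqP; rewrite eqEfsubset hsub fsubUset !fsub1set hi0 hi1.
  + suff -> : rho' = [fset i] by apply: h1; lia.
    apply/eqP; rewrite eqEfsubset fsub1set hi0 andbT; apply/fsubsetP => j hj.
    have := fsubsetP hsub j hj; rewrite !inE => /orP[] // /eqP hj1.
    by rewrite hj1 hi1 in hj.
  + suff -> : rho' = [fset i.+1] by apply: h1; lia.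
    apply/eqP; rewrite eqEfsubset fsub1set hi1 andbT; apply/fsubsetP => j hj.
    have := fsubsetP hsub j hj; rewrite !inE => /orP[] // /eqP hj1.
    by rewrite hj1 hi0 in hj.
  + suff -> : rho' = fset0 by [].
    apply/eqP; rewrite -fsubset0; apply/fsubsetP => j hj.
    have := fsubsetP hsub j hj; rewrite !inE => /orP[] /eqP hj1.
      by rewrite hj1 hi0 in hj.
    by rewrite hj1 hi1 in hj.
Qed.

(** * Subdividing an edge *)

Lemma path_copy_interior (V : choiceType) (s : nat) (K : {fset {fset V}})
    (sigma : {fset V}) (g : nat -> V) (i : nat) (tau : {fset V}) :
  simplicial_complex K -> path_copy s K sigma g ->
  (0 < i <= s)%N -> tau \in K -> g i \notin tau.
Proof.
move=> [_ Kdown] [_ _ gnew] hi htau; apply/negP => hgi.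
suff : [fset g i] \notin K.
  by rewrite (Kdown tau) // fsub1set.
by apply: gnew; rewrite in_fsetD mem_path_vertices !inE; lia.
Qed.

Lemma path_copy_sigma (V : choiceType) (s : nat) (K : {fset {fset V}})
    (sigma : {fset V}) (g : nat -> V) :
  path_copy s K sigma g -> sigma = [fset g 0%N; g s.+1].
Proof.
by move=> [_ <- _]; rewrite /path_endpoints imfsetU !imfset_fset1.
Qed.

(** A face of the link avoids the two endpoints because it is disjoint from the
    edge, and the inner vertices because they are fresh.  So a face of the copy
    and a face of the link can be recovered from their union. *)
Lemma path_copy_link (V : choiceType) (s : nat) (K : {fset {fset V}})
    (sigma : {fset V}) (g : nat -> V) (i : nat) (tau : {fset V}) :
  simplicial_complex K -> path_copy s K sigma g ->
  (i <= s.+1)%N -> tau \in link K sigma -> g i \notin tau.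
Proof.
move=> Kc cp hi; rewrite mem_link => /and3P[htau /fdisjointP hdisj _].
have [hi1|hi1] := boolP (0 < i <= s)%N.
  exact: (path_copy_interior Kc cp hi1 htau).
apply: hdisj; rewrite (path_copy_sigma cp) !inE.
have [->|->] : i = 0%N \/ i = s.+1 by lia.
  by rewrite eqxx.
by rewrite eqxx orbT.
Qed.

Lemma mem_path_copy (V : choiceType) (s : nat) (K : {fset {fset V}})
    (sigma : {fset V}) (g : nat -> V) (rho : {fset nat}) (i : nat) :
  path_copy s K sigma g -> rho `<=` path_vertices s -> (i <= s.+1)%N ->
  (g i \in g @` rho) = (i \in rho).
Proof.
move=> [ginj _ _] hrho hi; apply/imfsetP/idP => [[j hj hij]|hir]; last by exists i.
rewrite (ginj i j) ?mem_path_vertices //; rewrite -mem_path_vertices.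
exact: fsubsetP hrho _ _.
Qed.

(** In a complex, the faces removed are exactly those containing the edge. *)
Lemma subdivideP (V : choiceType) (s : nat) (K : {fset {fset V}})
    (sigma : {fset V}) (g : nat -> V) (kappa : {fset V}) :
  simplicial_complex K ->
  reflect ((kappa \in K /\ ~~ (sigma `<=` kappa)) \/
           exists rho tau, [/\ rho \in path_complex s, tau \in link K sigma &
                               kappa = (g @` rho) `|` tau])
    (kappa \in subdivide s K sigma g).
Proof.
move=> [_ Kdown]; rewrite in_fsetU in_fsetD.
have -> : (kappa \notin [fset sigma `|` tau | tau in link K sigma])
            && (kappa \in K) = (kappa \in K) && ~~ (sigma `<=` kappa).
  rewrite andbC; case hk : (kappa \in K) => //=; congr (~~ _).
  apply/imfsetP/idP => [[tau _ ->]|hs]; first exact: fsubsetUl.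
  have e : sigma `|` (kappa `\` sigma) = kappa.
    by rewrite fsetUDl fsetDv fsetD0; apply/fsetUidPr.
  exists (kappa `\` sigma) => //=.
  rewrite mem_link e hk andbT (Kdown kappa) ?fsubsetDl //=.
  by apply/fdisjointP => v hv; rewrite in_fsetD hv.
apply: (iffP orP) => -[].
- by move=> /andP[]; left.
- move=> /imfset2P[rho /= hrho [tau /= htau ->]]; right.
  by exists rho, tau.
- by move=> [-> ->]; left.
- move=> [rho [tau [hrho htau ->]]]; right; apply/imfset2P.
  by exists rho => //; exists tau.
Qed.

Lemma subdivide_simplicial (V : choiceType) (s : nat) (K : {fset {fset V}})
    (sigma : {fset V}) (g : nat -> V) :
  simplicial_complex K -> path_copy s K sigma g ->
  simplicial_complex (subdivide s K sigma g).
Proof.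
move=> Kc cp; have [K0 Kdown] := Kc; split=> [|kappa kappa'].
  apply/subdivideP => //; left; split=> //.
  rewrite fsubset0 (path_copy_sigma cp); apply/fset0Pn; exists (g 0%N).
  by rewrite !inE eqxx.
move=> /(subdivideP _ _ _ _ Kc)[[hk hs] hsub|[rho [tau [hrho htau ->]]] hsub].
  apply/subdivideP => //; left; split; first exact: Kdown hsub.
  by apply: contra hs => hs; apply: fsubset_trans hsub.
apply/subdivideP => //; right.
exists [fset i in rho | g i \in kappa'], (kappa' `&` tau); split.
- apply: (path_complex_simplicial s).2 hrho _.
  by apply/fsubsetP => i; rewrite !inE => /andP[].
- move: htau; rewrite !mem_link => /and3P[h1 h2 h3]; apply/and3P; split.
  + by apply: Kdown h1 _; apply: fsubsetIr.
  + by apply: fdisjointWr h2; apply: fsubsetIr.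
  + by apply: Kdown h3 _; apply: fsetUS; apply: fsubsetIr.
- apply/fsetP => v; rewrite in_fsetU in_fsetI.
  apply/idP/orP => [hv|].
    have := fsubsetP hsub v hv; rewrite in_fsetU => /orP[/imfsetP[i /= hi vi]|hvt].
      by left; apply/imfsetP; exists i; rewrite //= !inE hi -vi.
    by right; rewrite hv.
  by case=> [/imfsetP[i /=]|/andP[] //]; rewrite !inE => /andP[_ hi] ->.
Qed.

(** When [s] is positive these are the faces of the path not contained in its
    boundary; a list is used because they index sums. *)
Definition inner_path_faces (s : nat) : seq {fset nat} :=
  [seq [fset i] | i <- iota 1 s] ++ [seq [fset i; i.+1] | i <- iota 0 s.+1].

Lemma uniq_inner_path_faces (s : nat) : uniq (inner_path_faces s).
Proof.
rewrite cat_uniq; apply/and3P; split.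
- by rewrite map_inj_uniq ?iota_uniq // => i j /fset1_inj.
- apply/hasPn => rho /mapP[i _ ->]; apply/negP => /mapP[j _].
  by move=> /(congr1 (fun A : {fset nat} => #|` A|)); rewrite cardfs1 cardfs2; lia.
- rewrite map_inj_uniq ?iota_uniq // => i j /fsetP e.
  by have := e i; have := e i.+1; have := e j; rewrite !inE !eqxx; lia.
Qed.

Lemma mem_inner_path_faces (s : nat) (rho : {fset nat}) :
  (1 <= s)%N ->
  (rho \in inner_path_faces s) =
    (rho \in path_complex s) && ~~ (rho `<=` path_endpoints s).
Proof.
move=> hs; rewrite mem_cat; apply/orP/andP.
  case=> /mapP[i]; rewrite mem_iota => hi ->; split.
  - by apply/path_complexP; constructor 2; exists i => //; lia.
  - by rewrite fsub1set !inE; lia.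
  - by apply/path_complexP; constructor 3; exists i => //; lia.
  - by rewrite fsubUset !fsub1set !inE; lia.
move=> [/path_complexP[->|[i hi ->]|[i hi ->]]].
- by rewrite fsub0set.
- rewrite fsub1set !inE => hi'; left; apply/mapP; exists i => //.
  by rewrite mem_iota; lia.
- by move=> _; right; apply/mapP; exists i => //; rewrite mem_iota; lia.
Qed.

Lemma mem_fset_sep (T : choiceType) (D : {fset T}) (P : pred T) (x : T) :
  (x \in [fset y in D | P y]) = (x \in D) && P x.
Proof. by rewrite !inE. Qed.

Lemma sum_star (V : choiceType) (A : nmodType) (K : {fset {fset V}})
    (sigma : {fset V}) (f : {fset V} -> A) :
  simplicial_complex K ->
  \sum_(kappa <- K | sigma `<=` kappa) f kappa =
    \sum_(tau <- link K sigma) f (sigma `|` tau).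
Proof.
move=> [_ Kdown]; rewrite -big_filter -(big_map (fun tau => sigma `|` tau) predT f).
have cancel tau : tau \in link K sigma -> (sigma `|` tau) `\` sigma = tau.
  rewrite mem_link => /and3P[_ h _]; rewrite fsetDUl fsetDv fset0U.
  by apply/fsetDidPl; rewrite fdisjoint_sym.
apply: perm_big; apply: uniq_perm; first by rewrite filter_uniq ?fset_uniq.
  rewrite map_inj_in_uniq ?fset_uniq // => tau1 tau2 h1 h2 e.
  by rewrite -(cancel _ h1) e cancel.
move=> kappa; rewrite mem_filter; apply/andP/mapP => [[hs hk]|[tau htau ->]].
  have e : sigma `|` (kappa `\` sigma) = kappa.
    by rewrite fsetUDl fsetDv fsetD0; apply/fsetUidPr.
  exists (kappa `\` sigma) => //.
  rewrite mem_link e hk andbT (Kdown kappa) ?fsubsetDl //=.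
  by apply/fdisjointP => v hv; rewrite in_fsetD hv.
by split; [exact: fsubsetUl | move: htau; rewrite mem_link => /and3P[]].
Qed.

Lemma inner_path_face_interior (s : nat) (rho : {fset nat}) :
  (1 <= s)%N -> rho \in inner_path_faces s ->
  exists i, (0 < i <= s)%N /\ i \in rho.
Proof.
move=> hs; rewrite mem_inner_path_faces // => /andP[hrho /fsubsetPn[i hi hi']].
exists i; split=> //; have := fsubsetP (path_complex_sub hrho) i hi.
by rewrite mem_path_vertices; move: hi'; rewrite !inE; lia.
Qed.

(** Faces of the path inside its boundary only contribute faces that were
    already present, so inner faces are enough; unlike [subdivideP], the two
    alternatives now exclude each other. *)
Lemma subdivide_innerP (V : choiceType) (s : nat) (K : {fset {fset V}})
    (sigma : {fset V}) (g : nat -> V) (kappa : {fset V}) :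
  (1 <= s)%N -> simplicial_complex K -> path_copy s K sigma g ->
  reflect ((kappa \in K /\ ~~ (sigma `<=` kappa)) \/
           exists rho tau, [/\ rho \in inner_path_faces s,
                               tau \in link K sigma &
                               kappa = (g @` rho) `|` tau])
    (kappa \in subdivide s K sigma g).
Proof.
move=> hs Kc cp; have [_ Kdown] := Kc.
apply: (iffP (subdivideP _ _ _ _ Kc)); last first.
  case=> [|[rho [tau [hrho htau ->]]]]; first by left.
  right; exists rho, tau; split=> //.
  by move: hrho; rewrite mem_inner_path_faces // => /andP[].
case=> [|[rho [tau [hrho htau ->]]]]; first by left.
have [hend|hend] := boolP (rho `<=` path_endpoints s); last first.
  by right; exists rho, tau; split=> //; rewrite mem_inner_path_faces // hrho.
left; move: (htau); rewrite mem_link => /and3P[h1 h2 h3]; split.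
  apply: Kdown h3 _; apply: fsetSU; rewrite (path_copy_sigma cp).
  apply/fsubsetP => v /imfsetP[i /= hi ->]; have := fsubsetP hend i hi.
  by rewrite !inE => /orP[] /eqP ->; rewrite eqxx ?orbT.
rewrite (path_copy_sigma cp) fsubUset !fsub1set !in_fsetU.
have n0 := path_copy_link Kc cp (leq0n _) htau.
have n1 := path_copy_link Kc cp (leqnn _) htau.
rewrite (negbTE n0) (negbTE n1) !orbF.
rewrite !(mem_path_copy cp (path_complex_sub hrho)) //.
by move/path_complexP: hrho => [->|[i hi ->]|[i hi ->]]; rewrite !inE; lia.
Qed.

(** The inner face and the face of the link are both determined by their union,
    so the new faces can be counted by pairs. *)
Lemma sum_subdivide (V : choiceType) (A : nmodType) (s : nat)
    (K : {fset {fset V}}) (sigma : {fset V}) (g : nat -> V)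
    (f : {fset V} -> A) :
  (1 <= s)%N -> simplicial_complex K -> path_copy s K sigma g ->
  \sum_(kappa <- subdivide s K sigma g) f kappa =
    \sum_(kappa <- K | ~~ (sigma `<=` kappa)) f kappa +
    \sum_(tau <- link K sigma) \sum_(rho <- inner_path_faces s)
      f (g @` rho `|` tau).
Proof.
move=> hs Kc cp; have [_ Kdown] := Kc.
have rho_of rho tau : rho \in path_complex s -> tau \in link K sigma ->
    rho = [fset i in path_vertices s | g i \in g @` rho `|` tau].
  move=> /path_complex_sub hrho htau; apply/fsetP => i.
  rewrite mem_fset_sep in_fsetU.
  have [hi|hi] := boolP (i \in path_vertices s); last first.
    by apply/negP => /(fsubsetP hrho); apply/negP.
  rewrite mem_path_vertices in hi.
  by rewrite (mem_path_copy cp) // (negbTE (path_copy_link Kc cp hi htau)) orbF.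
have tau_of rho tau : rho \in path_complex s -> tau \in link K sigma ->
    tau = (g @` rho `|` tau) `\` g @` path_vertices s.
  move=> /path_complex_sub hrho htau; rewrite fsetDUl.
  have -> : g @` rho `\` g @` path_vertices s = fset0.
    apply/eqP; rewrite fsetD_eq0; apply/fsubsetP => v /imfsetP[i /= hi ->].
    by apply/imfsetP; exists i => //; apply: fsubsetP hrho _ _.
  rewrite fset0U; apply/esym/fsetDidPl/fdisjointP => v hv.
  apply/negP => /imfsetP[i hi vi]; move: hv; rewrite vi; apply/negP.
  have hi' : (i <= s.+1)%N by rewrite -mem_path_vertices.
  exact: path_copy_link Kc cp hi' htau.
rewrite -[X in X + _]big_filter.
rewrite -(big_allpairs_dep (h := fun tau (rho : {fset nat}) => g @` rho `|` tau)
            (F := f)) -big_cat.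
apply: perm_big; apply: uniq_perm; first exact: fset_uniq.
  rewrite cat_uniq filter_uniq ?fset_uniq //=; apply/andP; split.
    apply/hasPn => kappa /allpairsP[[tau rho] /= [htau hrho ->]].
    rewrite mem_filter negb_and; apply/orP; right.
    have [i [hi hir]] := inner_path_face_interior hs hrho.
    apply/negP => hk; have := path_copy_interior Kc cp hi hk.
    by rewrite in_fsetU in_imfset.
  apply: allpairs_uniq; rewrite ?fset_uniq ?uniq_inner_path_faces //.
  move=> [tau1 rho1] [tau2 rho2] /allpairsP[[? ?] /= [h1 + [-> ->]]].
  rewrite mem_inner_path_faces // => /andP[h2 _].
  move=> /allpairsP[[? ?] /= [h3 + [-> ->]]].
  rewrite mem_inner_path_faces // => /andP[h4 _] e; congr (_, _).
    by rewrite (tau_of _ _ h2 h1) e -tau_of.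
  by rewrite (rho_of _ _ h2 h1) e -rho_of.
move=> kappa; rewrite mem_cat mem_filter.
apply/(subdivide_innerP _ hs Kc cp)/orP.
  case=> [[-> ->]|[rho [tau [hrho htau ->]]]]; first by left.
  by right; apply/allpairsP; exists (tau, rho).
case=> [/andP[-> ->]|/allpairsP[[tau rho] /= [htau hrho ->]]]; first by left.
by right; exists rho, tau.
Qed.

(** * The weight preserved by subdivisions *)

(** The recurrence balances the weights of the inner faces of the path against
    the weight of the edge they replace.  The initial values make the final
    weight count the faces having exactly one old vertex, i.e., those of the
    links of the old vertices. *)
Fixpoint second_kind_seq (A : comNzRingType) (s : nat) (t : A) (k : nat) : A :=
  if k is k'.+1 then
    if k' is k''.+1 then
      t *+ 2 * second_kind_seq s t k'
        + (t *+ s + t ^+ 2 *+ s.-1) * second_kind_seq s t k''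
    else 1
  else 0.

(** [O] is the set of old vertices. *)
Definition face_weight (A : comNzRingType) (s : nat) (t : A) (V : choiceType)
    (O tau : {fset V}) : A :=
  t ^+ #|` tau `\` O| * second_kind_seq s t #|` tau `&` O|.

Lemma card_insertD (V : choiceType) (O tau : {fset V}) (v : V) :
  v \notin tau -> #|` (v |` tau) `\` O| = ((v \notin O) + #|` tau `\` O|)%N.
Proof.
move=> hv; rewrite fsetDUl; have [hO|hO] := boolP (v \in O).
  have -> : [fset v] `\` O = fset0 by apply/eqP; rewrite fsetD_eq0 fsub1set.
  by rewrite fset0U.
have -> : [fset v] `\` O = [fset v] by apply/fsetDidPl; rewrite fdisjoint1X.
by rewrite cardfsU1 !inE (negbTE hv) andbF.
Qed.

Lemma card_insertI (V : choiceType) (O tau : {fset V}) (v : V) :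
  v \notin tau -> #|` (v |` tau) `&` O| = ((v \in O) + #|` tau `&` O|)%N.
Proof.
move=> hv; rewrite fsetIUl; have [hO|hO] := boolP (v \in O).
  have -> : [fset v] `&` O = [fset v] by apply/fsetIidPl; rewrite fsub1set.
  by rewrite cardfsU1 !inE (negbTE hv).
have -> : [fset v] `&` O = fset0.
  by apply/eqP; rewrite fsetI_eq0 fdisjoint1X.
by rewrite fset0U.
Qed.

(** If [tau] has [m] new and [j] old vertices, the [s] inner vertices contribute
    [s t ^+ (m + 1) q_j], the two extreme edges [2 t ^+ (m + 1) q_(j + 1)], and
    the other [s - 1] edges [t ^+ (m + 2) q_j] each; the sum is
    [t ^+ m q_(j + 2)] by the recurrence. *)
Lemma face_weight_inner (A : comNzRingType) (s : nat) (t : A) (V : choiceType)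
    (K : {fset {fset V}}) (O sigma : {fset V}) (g : nat -> V) (tau : {fset V}) :
  (1 <= s)%N -> simplicial_complex K -> path_copy s K sigma g ->
  sigma `<=` O -> (forall v, v \in O -> [fset v] \in K) ->
  tau \in link K sigma ->
  \sum_(rho <- inner_path_faces s) face_weight s t O (g @` rho `|` tau) =
    face_weight s t O (sigma `|` tau).
Proof.
move=> hs Kc cp hsO OK htau.
have [g0O gsO] : g 0%N \in O /\ g s.+1 \in O.
  by split; apply: (fsubsetP hsO); rewrite (path_copy_sigma cp) !inE eqxx ?orbT.
have giO i : (0 < i <= s)%N -> g i \in O = false.
  move=> hi; apply/negP => /OK hK.
  by have := path_copy_interior Kc cp hi hK; rewrite !inE eqxx.
have gtau i : (i <= s.+1)%N -> g i \notin tau.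
  by move=> hi; exact: (path_copy_link Kc cp hi htau).
have ginj i j : (i <= s.+1)%N -> (j <= s.+1)%N -> i != j -> g i \notin (g j |` tau).
  move=> hi hj; rewrite !inE negb_or gtau // andbT; apply: contra => /eqP e.
  by have [inj _ _] := cp; apply/eqP; apply: inj; rewrite ?mem_path_vertices.
have w1 i : (0 < i <= s)%N -> face_weight s t O (g @` [fset i] `|` tau) =
    t * face_weight s t O tau.
  move=> hi; rewrite imfset_fset1 /face_weight.
  rewrite card_insertD ?card_insertI ?gtau ?giO //; try lia.
  by rewrite exprS mulrA.
have e2 i j : g @` [fset i; j] `|` tau = g i |` (g j |` tau).
  by rewrite imfsetU !imfset_fset1 fsetUA.
rewrite big_cat !big_map.
have -> : iota 0 s.+1 = 0%N :: iota 1 s.-1 ++ [:: s].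
  by have := iotaD 1 s.-1 1; rewrite addn1 add1n prednK //= => <-.
rewrite big_cons big_cat big_seq1 /=.
have sum_iota m (f : nat -> A) (b : A) :
    (forall i, (0 < i <= m)%N -> f i = b) -> \sum_(i <- iota 1 m) f i = b *+ m.
  move=> hf; rewrite big_seq (eq_bigr (fun=> b)) => [|i].
    by rewrite -big_seq big_const_seq count_predT size_iota -Monoid.iteropE.
  by rewrite mem_iota => hi; apply: hf; lia.
rewrite (sum_iota _ _ (t * face_weight s t O tau)) => [|i hi]; last exact: w1.
have w2 i j : (i <= s.+1)%N -> (j <= s.+1)%N -> i != j ->
    face_weight s t O (g i |` (g j |` tau)) =
    t ^+ ((g i \notin O) + ((g j \notin O) + #|` tau `\` O|)) *
    second_kind_seq s t ((g i \in O) + ((g j \in O) + #|` tau `&` O|)).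
  by move=> hi hj hij; rewrite /face_weight !card_insertD ?card_insertI ?ginj ?gtau.
rewrite (sum_iota _ _ (t ^+ 2 * face_weight s t O tau)) => [|i hi]; last first.
  rewrite e2 w2 ?(giO i) ?(giO i.+1); try lia.
  by rewrite /= !add1n !add0n !exprS /face_weight; ring.
rewrite (e2 0%N 1%N) (e2 s s.+1) (path_copy_sigma cp) -fsetUA.
rewrite !w2 ?g0O ?gsO ?(giO 1%N) ?(giO s); try lia.
rewrite /face_weight /= !add0n !add1n /=.
by rewrite !exprS; ring.
Qed.

(** * Sums over the links of the old vertices *)

Definition half_shift (R : realType) : {poly R} := 2^-1 *: ('X - 1).

Lemma Fpoly_sum (R : realType) (V : choiceType) (K : {fset {fset V}}) :
  Fpoly R K = \sum_(tau <- K) half_shift R ^+ #|` tau|.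
Proof.
have cardK j : (nb_faces K j)%:R = \sum_(tau <- K | #|` tau| == j) 1 :> R.
  by rewrite /nb_faces big_fset_condE card_fset_sum1 natr_sum.
rewrite /Fpoly (eq_bigr (fun j => \sum_(tau <- K | #|` tau| == j)
    half_shift R ^+ #|` tau|)) => [|j _].
  rewrite (exchange_big_dep predT) //= [RHS]big_seq [LHS]big_seq.
  apply: eq_bigr => tau htau; rewrite big_mkord.
  have hc : (#|` tau| < (Defs.max_card K).+1)%N.
    by rewrite ltnS; apply: (leq_bigmax_seq (F := fun tau : {fset V} => #|` tau|)).
  by rewrite (big_pred1 (Ordinal hc)).
rewrite cardK scaler_suml; apply: eq_bigr => tau /eqP ->.
by rewrite scale1r.
Qed.

Lemma sum_weight_subdivide (A : comNzRingType) (s : nat) (t : A)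
    (V : choiceType) (K : {fset {fset V}}) (O sigma : {fset V})
    (g : nat -> V) :
  (1 <= s)%N -> simplicial_complex K -> path_copy s K sigma g ->
  sigma `<=` O -> (forall v, v \in O -> [fset v] \in K) ->
  \sum_(kappa <- subdivide s K sigma g) face_weight s t O kappa =
  \sum_(kappa <- K) face_weight s t O kappa.
Proof.
move=> hs Kc cp hsO OK; rewrite sum_subdivide //.
rewrite [RHS](bigID (fun kappa => sigma `<=` kappa)) /= addrC sum_star //.
congr (_ + _); rewrite big_seq [RHS]big_seq.
by apply: eq_bigr => tau htau; apply: face_weight_inner htau.
Qed.

(** The last property says that a face with only old vertices comes from [K] and
    is not an edge already subdivided: a subdivision removes its edge, and every
    face it creates has a new vertex. *)
Lemma chain_invariant (A : comNzRingType) (s : nat) (t : A)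
    (V : choiceType) (O : {fset V}) (es : seq {fset V})
    (K K' : {fset {fset V}}) :
  (1 <= s)%N -> simplicial_complex K ->
  (forall v, v \in O -> [fset v] \in K) ->
  (forall sigma, sigma \in es -> sigma `<=` O) ->
  tchebyshev_chain s K es K' ->
  [/\ \sum_(kappa <- K') face_weight s t O kappa =
      \sum_(kappa <- K) face_weight s t O kappa,
      simplicial_complex K' &
      forall kappa, kappa \in K' -> kappa `<=` O ->
        kappa \in K /\ kappa \notin es].
Proof.
move=> hs; elim: es K => [|sigma es IH] K Kc OK esO /=; first by move=> ->.
have hsO : sigma `<=` O by apply: esO; rewrite inE eqxx.
move=> [g [K1 [cp eK1 K1c chain]]].
have OK1 v : v \in O -> [fset v] \in K1.
  move=> hv; rewrite eK1; apply/subdivideP => //; left; split; first exact: OK.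
  rewrite (path_copy_sigma cp); apply/negP => /fsubset_leq_card.
  rewrite cardfs2 cardfs1; have [inj _ _] := cp.
  suff -> : g 0%N != g s.+1 by [].
  apply/eqP => e; suff : 0%N = s.+1 by [].
  by apply: inj; rewrite ?mem_path_vertices.
have esO' tau : tau \in es -> tau `<=` O by move=> h; apply: esO; rewrite inE h orbT.
have [sumE K'c old] := IH K1 K1c OK1 esO' chain.
split=> //; first by rewrite sumE eK1 sum_weight_subdivide.
move=> kappa hk hkO; have [hk1 hkes] := old _ hk hkO.
move: hk1; rewrite eK1 => /(subdivide_innerP _ hs Kc cp) [[hkK hsk]|].
  split=> //; rewrite inE negb_or hkes andbT.
  by apply: contra hsk => /eqP ->.
move=> [rho [tau [hrho _ ek]]]; exfalso.
have [i [hi hir]] := inner_path_face_interior hs hrho.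
have /OK hgi : g i \in O.
  by apply: (fsubsetP hkO); rewrite ek in_fsetU in_imfset.
by have := path_copy_interior Kc cp hi hgi; rewrite inE eqxx.
Qed.

(** Both sides are total weights: the right-hand side is that of [K], all of
    whose vertices are old, and the left-hand side that of [K'], where a face
    has at most one old vertex and so belongs to the star of at most one. *)
Lemma sum_vertex_links (R : realType) (s : nat) (V : choiceType)
    (K K' : {fset {fset V}}) :
  (1 <= s)%N -> simplicial_complex K -> tchebyshev_triangulation s K K' ->
  \sum_(sigma <- K | #|` sigma| == 1%N) Fpoly R (link K' sigma) =
  \sum_(tau <- K) second_kind_seq s (half_shift R) #|` tau|.
Proof.
move=> hs Kc [es [_ esE chain]]; have [_ Kdown] := Kc.
set t := half_shift R; pose O := \bigcup_(tau <- K) tau.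
have mem_O v : (v \in O) = ([fset v] \in K).
  apply/bigfcupP/idP => [[tau /andP[htau _] hv]|hv].
    by apply: Kdown htau _; rewrite fsub1set.
  by exists [fset v]; rewrite ?hv // inE.
have sub_O tau : tau \in K -> tau `<=` O.
  by move=> h; apply/fsubsetP => v hv; apply/bigfcupP; exists tau; rewrite ?h.
have mem_es sigma : (sigma \in es) = (sigma \in K) && (#|` sigma| == 2%N).
  by rewrite esE !inE.
have OK v : v \in O -> [fset v] \in K by rewrite mem_O.
have esO sigma : sigma \in es -> sigma `<=` O.
  by rewrite mem_es => /andP[/sub_O].
have [sumE K'c old] := chain_invariant t hs Kc OK esO chain.
transitivity (\sum_(kappa <- K) face_weight s t O kappa); last first.
  rewrite big_seq [RHS]big_seq; apply: eq_bigr => tau /sub_O htau.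
  rewrite /face_weight (fsetIidPl htau).
  by move: htau; rewrite -fsetD_eq0 => /eqP ->; rewrite cardfs0 mul1r.
rewrite -sumE.
(* two old vertices in a face of K' would span an edge of K *)
have le1 kappa : kappa \in K' -> (#|` kappa `&` O| <= 1)%N.
  move=> hk; rewrite leqNgt; apply/negP => hgt.
  have /fset0Pn[u hu] : kappa `&` O != fset0 by rewrite -cardfs_gt0; lia.
  have /fset0Pn[v] : (kappa `&` O) `\ u != fset0.
    by rewrite -cardfs_gt0; move: hgt; rewrite (cardfsD1 u) hu; lia.
  rewrite in_fsetD1 => /andP[uv hv].
  have esub : [fset u; v] `<=` kappa `&` O by rewrite fsubUset !fsub1set hu.
  move: esub; rewrite fsubsetI => /andP[esk esO'].
  have [hK] := old _ (K'c.2 _ _ hk esk) esO'.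
  by rewrite mem_es hK cardfs2 (eq_sym u v) uv.
transitivity (\sum_(v <- O) Fpoly R (link K' [fset v])).
  rewrite -big_filter.
  rewrite -(big_map (fun v => [fset v]) predT
              (fun sigma => Fpoly R (link K' sigma))).
  apply: perm_big; apply: uniq_perm; rewrite ?filter_uniq ?fset_uniq //.
    by rewrite map_inj_uniq ?fset_uniq // => u v /fset1_inj.
  move=> sigma; rewrite mem_filter; apply/andP/mapP => [[/cardfs1P[v ->] hv]|[v hv ->]].
    by exists v; rewrite ?mem_O.
  by rewrite cardfs1 OK.
transitivity (\sum_(v <- O) \sum_(kappa <- K' | v \in kappa) t ^+ #|` kappa|.-1).
  apply: eq_bigr => v _; rewrite Fpoly_sum.
  under [RHS]eq_bigl => kappa do rewrite -fsub1set.
  rewrite sum_star // big_seq [RHS]big_seq; apply: eq_bigr => tau.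
  rewrite mem_link fdisjoint1X => /and3P[_ hv _].
  by rewrite cardfsU1 hv.
rewrite (exchange_big_dep predT) //= big_seq [RHS]big_seq.
apply: eq_bigr => kappa hk.
have -> : \sum_(v <- O | v \in kappa) t ^+ #|` kappa|.-1
          = t ^+ #|` kappa|.-1 *+ #|` kappa `&` O|.
  rewrite big_fset_condE big_const_seq count_predT -Monoid.iteropE.
  by congr (_ *+ #|` _|); apply/fsetP => v; rewrite !inE andbC.
rewrite /face_weight -(cardfsID O kappa).
case: #|` kappa `&` O| (le1 _ hk) => [|[|]] //= _.
  by rewrite mulr0n mulr0.
by rewrite mulr1 mulr1n.
Qed.

(** * Existence of triangulations and the values of U *)

(** Numbers larger than every vertex of [K] and than the endpoints serve as
    fresh vertices. *)
Lemma path_copy_exists (s : nat) (K : {fset {fset nat}}) (sigma : {fset nat}) :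
  #|` sigma| = 2%N -> exists g, path_copy s K sigma g.
Proof.
move=> hs.
have [a ha] : exists a, a \in sigma by apply/fset0Pn; rewrite -cardfs_gt0 hs.
have [b] : exists b, b \in sigma `\ a.
  by apply/fset0Pn; rewrite -cardfs_gt0; move: hs; rewrite (cardfsD1 a) ha; lia.
rewrite in_fsetD1 => /andP[hba hb].
have esigma : [fset a; b] = sigma.
  apply/eqP; rewrite eqEfcard fsubUset !fsub1set ha hb /= hs cardfs2.
  by rewrite eq_sym hba.
pose N := (\max_(tau <- K) \max_(v <- tau) v)%N.
have ltN tau v : tau \in K -> v \in tau -> (v <= N)%N.
  pose F (tau : {fset nat}) := (\max_(v <- tau) v)%N.
  move=> htau hv; apply: leq_trans (leq_bigmax_seq (F := F) _ htau isT).
  exact: (leq_bigmax_seq (F := id) v).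
pose g i := if i == 0%N then a else if i == s.+1 then b else (a + b + N + i)%N.
exists g; split.
- move=> i j; rewrite !mem_path_vertices /g.
  move: hba; case: (i =P 0%N); case: (j =P 0%N); case: (i =P s.+1);
    by case: (j =P s.+1); lia.
- by rewrite /path_endpoints imfsetU !imfset_fset1 /g eqxx /= eqxx.
- move=> i; rewrite in_fsetD mem_path_vertices !inE => hi.
  apply/negP => /ltN /(_ (fset11 _)).
  by rewrite /g; case: (i =P 0%N); case: (i =P s.+1); lia.
Qed.

Lemma tchebyshev_chain_exists (s : nat) (es : seq {fset nat})
    (K : {fset {fset nat}}) :
  simplicial_complex K -> (forall sigma, sigma \in es -> #|` sigma| = 2%N) ->
  exists K', tchebyshev_chain s K es K'.
Proof.
elim: es K => [|sigma es IH] K Kc /=; first by exists K.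
move=> hes; have [g cp] := path_copy_exists s K (hes sigma (mem_head _ _)).
have K1c := subdivide_simplicial Kc cp.
have [tau htau|K' chain] := IH _ K1c; first by apply: hes; rewrite inE htau orbT.
by exists K', g, (subdivide s K sigma g).
Qed.

Lemma tchebyshev_triangulation_exists (s : nat) (K : {fset {fset nat}}) :
  simplicial_complex K -> exists K', tchebyshev_triangulation s K K'.
Proof.
move=> Kc; have [|K' chain] := @tchebyshev_chain_exists s (edges K) K Kc.
  by move=> sigma; rewrite !inE => /andP[_ /eqP].
by exists K', (edges K); split; rewrite ?fset_uniq.
Qed.

(** In the full simplex on [k] vertices every proper face has a smaller
    cardinality, so the induction hypothesis cancels all terms of the
    characteristic identity but that of the top face. *)
Lemma tchebyshev_U_half_shift (R : realType) (s : nat)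
    (U : {linear {poly R} -> {poly R}}) (k : nat) :
  (1 <= s)%N -> is_tchebyshev_U s U ->
  U (half_shift R ^+ k) = second_kind_seq s (half_shift R) k.
Proof.
move=> hs [_ hU]; elim/ltn_ind: k => k IH.
pose S := [fset i in iota 0 k]; pose K := fpowerset S.
have cardS : #|` S| = k.
  by rewrite card_fseq undup_id ?iota_uniq // size_iota.
have Kc : simplicial_complex K.
  split=> [|sigma tau]; rewrite !fpowersetE ?fsub0set // => h1 h2.
  exact: fsubset_trans h2 h1.
have [K' hK'] := tchebyshev_triangulation_exists s Kc.
have := hU _ _ _ Kc hK'; rewrite (sum_vertex_links R hs Kc hK') Fpoly_sum linear_sum /=.
have SK : S \in K by rewrite fpowersetE.
rewrite !(big_fsetD1 S SK) /= cardS.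
have -> : \sum_(tau <- K `\ S) U (half_shift R ^+ #|` tau|) =
    \sum_(tau <- K `\ S) second_kind_seq s (half_shift R) #|` tau|.
  rewrite big_seq [RHS]big_seq; apply: eq_bigr => tau.
  rewrite in_fsetD1 fpowersetE => /andP[hne hsub].
  by apply: IH; rewrite -cardS; apply: fproper_ltn_card; rewrite fproperEneq hne.
by move/addIr.
Qed.

(** * The three-term recurrence *)

(** Substituting [2 X + 1], the compositional inverse of [half_shift], gives the
    coefficients. *)
Lemma half_shift_expansion (R : realType) (p : {poly R}) :
  exists a : {poly R}, p = \sum_(i < size a) a`_i *: half_shift R ^+ i.
Proof.
exists (p \Po ('X *+ 2 + 1)); rewrite -comp_polyE -comp_polyA.
suff -> : ('X *+ 2 + 1) \Po half_shift R = 'X by rewrite comp_polyXr.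
rewrite comp_polyD mulr2n comp_polyD -mulr2n comp_polyX -polyC1 comp_polyC /half_shift.
by rewrite scalerMnl -[_ *+ 2]mulr_natr mulVf ?pnatr_eq0 // scale1r polyC1 subrK.
Qed.

(** By linearity, since the identity holds when [p] is a power of
    [half_shift]. *)
Lemma tchebyshev_U_recurrence (R : realType) (s : nat)
    (U : {linear {poly R} -> {poly R}}) (p : {poly R}) :
  (1 <= s)%N -> is_tchebyshev_U s U ->
  let h := half_shift R in
  U (h ^+ 2 * p) = h *+ 2 * U (h * p) + (h *+ s + h ^+ 2 *+ s.-1) * U p.
Proof.
move=> hs hU h; have [a ->] := half_shift_expansion p; rewrite -/h.
rewrite !mulr_sumr !linear_sum /= !mulr_sumr -big_split /=.
apply: eq_bigr => i _; rewrite -!scalerAr -exprS -exprD !linearZ /=.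
rewrite !(tchebyshev_U_half_shift _ hs hU) /= -!scalerAr -scalerDr.
by [].
Qed.

(** With [X = 2 h + 1], the recurrence for the powers of [h] turns into one for
    the powers of [X], whose characteristic polynomial in [z] is
    [z ^+ 2 - 2 X z + discr_poly]. *)
Definition discr_poly (R : realType) (s : nat) : {poly R} :=
  s%:R - 'X ^+ 2 *+ s.-1.

Definition second_kind_recurrence (R : realType) (s : nat)
    (P : nat -> {poly R}) : Prop :=
  [/\ P 0%N = 1, P 1%N = 'X *+ 2 &
      forall n, P n.+2 = 'X *+ 2 * P n.+1 - discr_poly R s * P n].

Lemma tchebyshev_U_poly_recurrence (R : realType) (s : nat)
    (U : {linear {poly R} -> {poly R}}) :
  (1 <= s)%N -> is_tchebyshev_U s U ->
  second_kind_recurrence s (tchebyshev_U_poly U).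
Proof.
move=> hs hU; set h := half_shift R.
have XE : 'X = h *+ 2 + 1 :> {poly R}.
  rewrite /h /half_shift scalerMnl -[_ *+ 2]mulr_natr mulVf ?pnatr_eq0 //.
  by rewrite scale1r subrK.
have U1 : U 1 = 0 by case: hU.
have Uh : U h = 1.
  by have := tchebyshev_U_half_shift 1 hs hU; rewrite expr1.
have UX p : U ('X * p) = U (h * p) *+ 2 + U p.
  by rewrite XE mulrDl mul1r mulrnAl linearD linearMn.
have UXX p : U ('X ^+ 2 * p) = 'X *+ 2 * U ('X * p) - discr_poly R s * U p.
  have -> : 'X ^+ 2 * p = (h ^+ 2 * p) *+ 4 + (h * p) *+ 4 + p by rewrite XE; ring.
  rewrite 2!linearD !linearMn UX (tchebyshev_U_recurrence p hs hU) -/h.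
  rewrite /discr_poly XE -[in s%:R](prednK hs) -[in h *+ s](prednK hs).
  by rewrite -natr1 mulrS; ring.
have half2 (q : {poly R}) : 2^-1 *: (q *+ 2) = q.
  by rewrite -scaler_nat scalerA mulVf ?pnatr_eq0 // scale1r.
rewrite /tchebyshev_U_poly; split=> [||n].
- by rewrite expr1 -['X]mulr1 UX U1 mulr1 Uh addr0 half2.
- rewrite -['X^2]mulr1 UXX mulr1 U1 mulr0 subr0 XE linearD linearMn Uh U1.
  by rewrite addr0 mulrnAr mulr1 half2.
- have -> : 'X^(n.+3) = 'X ^+ 2 * 'X^(n.+1) :> {poly R} by rewrite -exprD.
  by rewrite UXX scalerBr -exprS !scalerAr.
Qed.

(** * Roots of polynomials satisfying the recurrence *)

Lemma horner_discr_poly (R : realType) (s : nat) (x : R) :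
  (discr_poly R s).[x] = s%:R - x ^+ 2 *+ s.-1.
Proof. by rewrite /discr_poly -polyC_natr !(hornerE, hornerMn). Qed.

Lemma size_second_kind (R : realType) (s : nat) (P : nat -> {poly R}) :
  second_kind_recurrence s P ->
  forall n, (size (P n) <= n.+1)%N.
Proof.
move=> [P0 P1 Prec] n.
have s2X : (size ('X *+ 2 : {poly R}) <= 2)%N.
  by rewrite -scaler_nat (leq_trans (size_scale_leq _ _)) ?size_polyX.
have sD : (size (discr_poly R s) <= 3)%N.
  rewrite /discr_poly (leq_trans (size_polyD _ _)) // size_polyN geq_max.
  rewrite -polyC_natr (leq_trans (size_polyC_leq1 _)) //=.
  by rewrite -scaler_nat (leq_trans (size_scale_leq _ _)) ?size_polyXn.
elim/ltn_ind: n => -[|[|n]] IH; first by rewrite P0 size_poly1.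
  by rewrite P1.
rewrite Prec (leq_trans (size_polyD _ _)) // size_polyN geq_max.
have h1 := IH n.+1 (ltnSn _); have h0 := IH n (leqW (ltnSn _)).
apply/andP; split; apply: leq_trans (size_polyMleq _ _) _.
  by move: (size _) (size _) s2X h1 => a b; lia.
by move: (size _) (size _) sD h0 => a b; lia.
Qed.

(** This rules out that the polynomial vanishes identically. *)
Lemma second_kind_at_1 (R : realType) (s : nat) (P : nat -> {poly R}) :
  (1 <= s)%N -> second_kind_recurrence s P ->
  forall n, (P n).[1] = n.+1%:R.
Proof.
move=> hs [P0 P1 Prec]; elim/ltn_ind => -[|[|n]] IH.
- by rewrite P0 hornerE.
- by rewrite P1 hornerMn hornerX.
- rewrite Prec hornerD hornerN !hornerM hornerMn hornerX horner_discr_poly.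
  rewrite !IH // expr1n -[in X in X%:R - _](prednK hs) -[_.-1.+1%:R]natr1.
  by rewrite -[n.+3]addn3 -[n.+2]addn2 -[n.+1]addn1 !natrD; ring.
Qed.

(** Division by [r ^+ n] turns the recurrence into the one satisfied by
    [sin (theta *+ n.+1)], which is the addition formula for [sin]. *)
Lemma second_kind_trig (R : realType) (s : nat) (P : nat -> {poly R}) (r theta : R) :
  second_kind_recurrence s P ->
  (discr_poly R s).[r * cos theta] = r ^+ 2 ->
  forall n, (P n).[r * cos theta] * sin theta = r ^+ n * sin (theta *+ n.+1).
Proof.
move=> [P0 P1 Prec] hr; elim/ltn_ind => -[|[|n]] IH.
- by rewrite P0 hornerE expr0 !mul1r.
- by rewrite P1 hornerMn hornerX sin_mulr2n expr1; ring.
- rewrite Prec hornerD hornerN !hornerM hornerMn hornerX hr.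
  have -> a b : (r * cos theta *+ 2 * a - r ^+ 2 * b) * sin theta =
      r * cos theta *+ 2 * (a * sin theta) - r ^+ 2 * (b * sin theta) by ring.
  rewrite !IH // (mulrS theta n.+2) (mulrS theta n.+1) !sinD !cosD.
  rewrite (exprS r n.+1) (exprS r n).
  set S := sin (theta *+ _); set C := cos (theta *+ _).
  apply/eqP; rewrite -subr_eq0; apply/eqP.
  transitivity (r * (r * r ^+ n) * S * (cos theta ^+ 2 + sin theta ^+ 2 - 1)).
    by ring.
  by rewrite cos2Dsin2 subrr mulr0.
Qed.

(** The positive solution [r] of [r ^+ 2 = (discr_poly R s).[r * c]]. *)
Definition root_radius (R : realType) (s : nat) (c : R) : R :=
  Num.sqrt (s%:R / (1 + c ^+ 2 *+ s.-1)).

Lemma root_radius_denom_gt0 (R : realType) (s : nat) (c : R) :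
  0 < 1 + c ^+ 2 *+ s.-1.
Proof. by rewrite ltr_wpDr // mulrn_wge0 // sqr_ge0. Qed.

Lemma root_radius_gt0 (R : realType) (s : nat) (c : R) :
  (1 <= s)%N -> 0 < root_radius s c.
Proof.
by move=> hs; rewrite sqrtr_gt0 divr_gt0 ?ltr0n ?root_radius_denom_gt0.
Qed.

Lemma discr_root_radius (R : realType) (s : nat) (c : R) :
  (discr_poly R s).[root_radius s c * c] = root_radius s c ^+ 2.
Proof.
have hd := root_radius_denom_gt0 s c.
rewrite horner_discr_poly exprMn sqr_sqrtr ?divr_ge0 ?ler0n ?ltW //.
rewrite -[_ *+ s.-1]mulr_natr; rewrite -[_ *+ s.-1]mulr_natr in hd *.
by field; rewrite gt_eqF.
Qed.

(** The value [x = r * c] determines [r ^+ 2] as the value of [discr_poly] at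
    [x], hence [r] and then [c]. *)
Lemma root_radius_mul_inj (R : realType) (s : nat) :
  (1 <= s)%N -> injective (fun c : R => root_radius s c * c).
Proof.
move=> hs c c' /= e.
have h : root_radius s c = root_radius s c'.
  apply/eqP; rewrite -(eqrXn2 (n := 2)) ?ltW ?root_radius_gt0 //.
  by rewrite -!discr_root_radius e.
by move: e; rewrite h => /mulfI; apply; rewrite gt_eqF ?root_radius_gt0.
Qed.

Lemma root_radius_mul_lt1 (R : realType) (s : nat) (c : R) :
  (1 <= s)%N -> c ^+ 2 < 1 -> -1 < root_radius s c * c < 1.
Proof.
move=> hs hc; rewrite -ltr_norml -(ltr_pXn2r (n := 2)) ?nnegrE ?normr_ge0 //.
rewrite expr1n real_normK ?num_real //.
have hd := root_radius_denom_gt0 s c.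
rewrite exprMn sqr_sqrtr ?divr_ge0 ?ler0n ?ltW // mulrAC ltr_pdivrMr // mul1r.
by rewrite mulr_natl -[in X in X < _](prednK hs) mulrS ltrD2r.
Qed.

Lemma sin_pi_muln (R : realType) (k : nat) : sin (pi *+ k) = 0 :> R.
Proof.
elim: k => [|k IH]; first by rewrite mulr0n sin0.
by rewrite mulrS addrC sinDpi IH oppr0.
Qed.

Definition root_angle (R : realType) (n k : nat) : R := pi * (k%:R / n.+1%:R).

Lemma root_angle_itv (R : realType) (n k : nat) :
  (0 < k <= n)%N -> 0 < root_angle R n k < pi.
Proof.
move=> /andP[k0 kn]; have hpi : 0 < pi :> R := pi_gt0 R.
rewrite /root_angle mulr_gt0 ?divr_gt0 ?ltr0n //=.
by rewrite gtr_pMr // ltr_pdivrMr ?ltr0n // mul1r ltr_nat ltnS.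
Qed.

Lemma second_kind_roots (R : realType) (s : nat) (P : nat -> {poly R}) :
  (1 <= s)%N -> second_kind_recurrence s P ->
  forall n, exists rs : seq R,
    [/\ uniq rs, size rs = n &
        forall x : R, (x \in rs) = [&& -1 < x, x < 1 & root (P n) x]].
Proof.
move=> hs Prec n.
pose rt k := let c := cos (root_angle R n k) in root_radius s c * c.
pose rs := [seq rt k | k <- iota 1 n].
have itv k : k \in iota 1 n -> 0 < root_angle R n k < pi.
  by rewrite mem_iota => hk; apply: root_angle_itv; lia.
have sin_neq0 k : k \in iota 1 n -> sin (root_angle R n k) != 0.
  by move=> /itv /sin_gt0_pi h; rewrite gt_eqF.
have rs_uniq : uniq rs.
  rewrite map_inj_in_uniq ?iota_uniq // => j k hj hk.
  move=> /(root_radius_mul_inj hs) /cos_inj e.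
  have /andP[j0 jpi] := itv j hj; have /andP[k0 kpi] := itv k hk.
  have /mulfI : pi != 0 :> R by rewrite gt_eqF ?pi_gt0.
  have : root_angle R n j = root_angle R n k.
    by apply: e; rewrite in_itv /= !ltW.
  move=> h /(_ _ _ h) /mulIf; rewrite invr_eq0 pnatr_eq0 => /(_ isT) /eqP.
  by rewrite eqr_nat => /eqP.
have rs_root : all (root (P n)) rs.
  apply/allP => _ /mapP[k hk ->]; rewrite rootE.
  have := second_kind_trig Prec (discr_root_radius s (cos (root_angle R n k))) n.
  rewrite -(mulr_natr (root_angle R n k)) /root_angle -mulrA.
  rewrite divfK ?pnatr_eq0 // mulr_natr.
  rewrite sin_pi_muln mulr0 => /eqP; rewrite mulf_eq0 => /orP[//|].
  by rewrite -/(root_angle R n k) (negbTE (sin_neq0 k hk)).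
have Pn0 : P n != 0.
  apply/eqP => h; have := second_kind_at_1 hs Prec n.
  by rewrite h horner0 => /esym /eqP; rewrite pnatr_eq0.
exists rs; split=> //; first by rewrite size_map size_iota.
move=> x; apply/idP/and3P => [hx|[_ _ hx]].
  have hroot := allP rs_root x hx.
  move/mapP: hx hroot => [k hk ->] hroot.
  suff /(root_radius_mul_lt1 hs) /andP[] : cos (root_angle R n k) ^+ 2 < 1 by [].
  by rewrite cos2sin2 gtrBl exprn_even_gt0 //= sin_neq0.
apply/negPn/negP => hx'.
have := max_poly_roots (rs := x :: rs) Pn0; rewrite /= hx rs_root hx' rs_uniq.
move=> /(_ isT isT); rewrite size_map size_iota ltnNge.
by rewrite (size_second_kind Prec n).
Qed.

Theorem proposition8p6 (R : realType) (s : nat) (hs : (1 <= s)%N)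
    (U : {linear {poly R} -> {poly R}}) (hU : is_tchebyshev_U s U) (n : nat) :
  exists rs : seq R,
    [/\ uniq rs, size rs = n &
        forall x : R,
          (x \in rs) = [&& -1 < x, x < 1 & root (tchebyshev_U_poly U n) x]].
Proof.
by apply: (second_kind_roots hs); apply: tchebyshev_U_poly_recurrence.
Qed.
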